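(* Let $\mathcal{C}$ be a uniform clutter (all edges of the same cardinality) on $n$ vertices whose incidence matrix has rank $n$, and let $I\subset R=K[y_1,\ldots,y_n]$ be its edge ideal. Assume $I$ is normal, and let $\mathbb{T}=\{[(x_1,\ldots,x_n)]\in\mathbb{P}^{n-1}: x_i\in K^*\}$ be the projective torus in $\mathbb{P}^{n-1}$. Then: (a) $\deg(S/I(X))=|X|=(q-1)^{n-1}$; (b) for every $d\geq 1$, $\delta_d\leq\delta_d'$, where $\delta_d$ is the minimum distance of $C_X(d)$ and $\delta_d'$ is the minimum distance of $C_{\mathbb{T}}(d)$; (c) $\mathrm{reg}(S/I(X))\leq \mathrm{reg}(S'/I(\mathbb{T}))=(q-2)(n-1)$, where $S'=K[t_1,\ldots,t_n]$.
   Context: Let $K=\mathbb{F}_q$ be a finite field with $q\neq 2$ elements. A clutter $\mathcal{C}$ with vertex set $\{y_1,\ldots,y_n\}$ is a family of subsets (edges) of this set such that no edge is contained in another; let its edges be $f_1,\ldots,f_s$ ($s\geq 2$) with characteristic vectors $v_i=\sum_{y_j\in f_i}e_j\in\{0,1\}^n$. The incidence matrix is the $n\times s$ matrix with columns $v_1,\ldots,v_s$. The edge ideal is $I=(y^{v_1},\ldots,y^{v_s})\subset R$; $I$ is normal if $I^i=\overline{I^i}$ for all $i\geq 1$, where $\overline{I^i}$ is the ideal generated by the monomials $y^a$ with $(y^a)^p\in I^{pi}$ for some integer $p\geq 1$. For a finite set $Y=\{[P_1],\ldots,[P_m]\}\subset\mathbb{P}^{r-1}$ whose points have all coordinates nonzero,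 with $S_Y=K[t_1,\ldots,t_r]$, let $I(Y)$ be the ideal generated by homogeneous polynomials vanishing on $Y$; the code $C_Y(d)$ is the image of the $K$-linear map $(S_Y)_d\to K^m$, $f\mapsto (f(P_1)/P_{1,1}^d,\ldots,f(P_m)/P_{m,1}^d)$; its minimum distance is $\min\{\|v\|:0\neq v\in C_Y(d)\}$, $\|v\|$ being the number of nonzero entries. $H_Y(d)=\dim_K(S_Y/I(Y))_d$; $\deg(S_Y/I(Y))$ is the multiplicity, which equals the constant value of $H_Y(d)$ for $d\gg0$; $\mathrm{reg}(S_Y/I(Y))$ is the least $p\geq 0$ with $H_Y(d)=|Y|$ for all $d\geq p$. Here $X=\{[(x^{v_1},\ldots,x^{v_s})]\in\mathbb{P}^{s-1}: x\in (K^* )^n\}$ with $x^{v_i}=\prod_j x_j^{v_{ij}}$, and $S=K[t_1,\ldots,t_s]$. *)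

(* Defs.v *)
From HB Require Import structures.
From mathcomp Require Import all_boot all_order all_algebra.
Set Implicit Arguments. Unset Strict Implicit. Unset Printing Implicit Defensive.
Import GRing.Theory.
Local Open Scope ring_scope.

Section Defs.
Variable K : finFieldType.

Definition is_clutter (n s : nat) (f : 'I_s -> {set 'I_n}) : Prop :=
  forall i j : 'I_s, i != j -> ~~ (f i \subset f j).

Definition is_uniform (n s : nat) (f : 'I_s -> {set 'I_n}) : Prop :=
  forall i j : 'I_s, #|f i| = #|f j|.

Definition incidence_mx (n s : nat) (f : 'I_s -> {set 'I_n}) : 'M[rat]_(n, s) :=
  \matrix_(k < n, i < s) ((k \in f i) : nat)%:R.

Definition charv (n s : nat) (f : 'I_s -> {set 'I_n}) (i : 'I_s) (k : 'I_n) : nat :=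
  (k \in f i).

(* the monomial y^a lies in I^i  <=>  it is divisible by a product of i generators *)
Definition mon_in_pow (n s : nat) (f : 'I_s -> {set 'I_n}) (i : nat) (a : 'I_n -> nat) : Prop :=
  exists js : i.-tuple 'I_s,
    forall k : 'I_n, (\sum_(j <- js) charv f j k <= a k)%N.

(* I normal: I^i = \bar{I^i} for all i >= 1 (both are monomial ideals, the
   inclusion I^i \subset \bar{I^i} being automatic) *)
Definition edge_ideal_normal (n s : nat) (f : 'I_s -> {set 'I_n}) : Prop :=
  forall i : nat, (0 < i)%N -> forall a : 'I_n -> nat,
    (exists p : nat, (0 < p)%N /\ mon_in_pow f (p * i) (fun k => p * a k)%N) ->
    mon_in_pow f i a.

(* the projective point [P] as the set of nonzero multiples of P *)
Definition pclass (r : nat) (P : 'rV[K]_r) : {set 'rV[K]_r} :=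
  [set c *: P | c in [set c : K | c != 0]].

Definition in_torus (r : nat) (x : 'rV[K]_r) : bool := [forall j, x 0 j != 0].

Definition proj_torus (r : nat) : {set {set 'rV[K]_r}} :=
  [set pclass x | x in [set x : 'rV[K]_r | in_torus x]].

Definition param_point (n s : nat) (f : 'I_s -> {set 'I_n}) (x : 'rV[K]_n) : 'rV[K]_s :=
  \row_(i < s) \prod_(j in f i) x 0 j.

Definition param_set (n s : nat) (f : 'I_s -> {set 'I_n}) : {set {set 'rV[K]_s}} :=
  [set pclass (param_point f x) | x in [set x : 'rV[K]_n | in_torus x]].

(* monomials of degree d in r variables (exponent vectors) ; they form a
   basis of (S)_d, S = K[t_1..t_r] *)
Definition mons (r d : nat) : {set {ffun 'I_r -> 'I_d.+1}} :=
  [set a : {ffun 'I_r -> 'I_d.+1} | (\sum_(i < r) (a i : nat) == d)%N].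

Definition mon_eval (r d : nat) (a : {ffun 'I_r -> 'I_d.+1}) (P : 'rV[K]_r) : K :=
  \prod_(i < r) P 0 i ^+ a i.

Definition rep (r : nat) (p : {set 'rV[K]_r}) : 'rV[K]_r := odflt 0 [pick x in p].

(* first coordinate P_{1} (0 if r = 0) *)
Definition fcoord (r : nat) (P : 'rV[K]_r) : K := head 0 [seq P 0 i | i <- enum 'I_r].

(* evaluation matrix of the degree-d monomials at the points of Y (rows:
   monomials, columns: points); a degree-d form with coefficient row vector c
   vanishes on Y iff c *m eval_mx Y d = 0 *)
Definition eval_mx (r : nat) (Y : {set {set 'rV[K]_r}}) (d : nat)
  : 'M[K]_(#|mons r d|, #|Y|) :=
  \matrix_(i < #|mons r d|, j < #|Y|) mon_eval (enum_val i) (rep (enum_val j)).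

(* generator matrix of C_Y(d): row i = (f(P_1)/P_{1,1}^d, ..., f(P_m)/P_{m,1}^d)
   for f the i-th monomial of degree d *)
Definition code_mx (r : nat) (Y : {set {set 'rV[K]_r}}) (d : nat)
  : 'M[K]_(#|mons r d|, #|Y|) :=
  \matrix_(i < #|mons r d|, j < #|Y|)
     (mon_eval (enum_val i) (rep (enum_val j)) / fcoord (rep (enum_val j)) ^+ d).

Definition hweight (m : nat) (v : 'rV[K]_m) : nat := #|[set j | v 0 j != 0]|.

Definition min_dist (r : nat) (Y : {set {set 'rV[K]_r}}) (d : nat) : nat :=
  \big[minn/#|Y|]_(v : 'rV[K]_#|Y| | (v != 0) && (v <= code_mx Y d)%MS) hweight v.

(* H_Y(d) = dim (S)_d - dim I(Y)_d, with I(Y)_d the degree-d forms vanishing on Y *)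
Definition hilb (r : nat) (Y : {set {set 'rV[K]_r}}) (d : nat) : nat :=
  (#|mons r d| - \rank (kermx (eval_mx Y d)))%N.

Definition is_degree (r : nat) (Y : {set {set 'rV[K]_r}}) (m : nat) : Prop :=
  exists d0 : nat, forall d : nat, (d0 <= d)%N -> hilb Y d = m.

Definition is_reg (r : nat) (Y : {set {set 'rV[K]_r}}) (p : nat) : Prop :=
  (forall d : nat, (p <= d)%N -> hilb Y d = #|Y|) /\
  (forall p' : nat, (forall d : nat, (p' <= d)%N -> hilb Y d = #|Y|) -> (p <= p')%N).

End Defs.

(* Main.v *)
(** Write Q = q - 1 and N = n - 1, and normalize points so that x_0 = 1.

    Lower bound for T: the sum of F(x) x_1 ... x_N over the normalized points x of T
    vanishes for every form F of degree less than N (Q - 1), so such a form is not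
    supported at a single point. On the other hand, a set S of points can be cut down
    to one point by linear factors t_i - c t_0 that isolate, coordinate after
    coordinate, the value taken least often: this costs e_i - 1 factors when e_i
    values occur, and the product of the e_i is at most |S|. Taking for S the support
    of F bounds |S| from below in terms of the degree of F.

    Upper bound for X: X is a subgroup of the torus, so all values of a coordinate are
    taken equally often. Killing them one linear factor at a time, coordinate after
    coordinate, gives in every degree a form with few nonzeros on X. If |X| = Q^N, then
    the same function of Q, N and d governs this bound and the previous one.

    That |X| = Q^N is where normality enters. Uniformity and rank n put e_a - e_b into
    the rational span of the edge vectors; normality then turns
    M (v_1 + ... + v_s) + e_a - e_b, for M large, into a sum of edge vectors. Hence
    x^{v_1} = ... = x^{v_s} forces x to be constant, and X is in bijection with T. *)

Require Import Defs.
From HB Require Import structures.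
From mathcomp Require Import all_boot all_order all_algebra.
From mathcomp Require Import finfield mpoly zify ring.
Set Implicit Arguments. Unset Strict Implicit. Unset Printing Implicit Defensive.
Import Order.TTheory GRing.Theory Num.Theory.
Local Open Scope ring_scope.

(** * The minimum distance of the torus *)

(* For [d = k * (Q - 1) + l] with [k < N] and [l < Q - 1] the value is
   [Q ^ (N - k - 1) * (Q - l)]; it is 1 for [d >= N * (Q - 1)]. *)
Fixpoint torus_min_dist (Q N d : nat) : nat :=
  (if N is N'.+1 then
     if d < Q then (Q - d) * Q ^ N' else torus_min_dist Q N' (d - Q.-1)
   else 1)%N.

Section TorusDistance.
Variable Q : nat.
Hypothesis Q_gt0 : (0 < Q)%N.

Lemma torus_min_dist0 N : torus_min_dist Q N 0 = (Q ^ N)%N.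
Proof. by case: N => //= N; rewrite Q_gt0 subn0 expnS. Qed.

Lemma torus_min_dist_gt0 N d : (0 < torus_min_dist Q N d)%N.
Proof.
elim: N d => //= N IH d; case: (ltnP d Q) => // dQ.
by rewrite muln_gt0 subn_gt0 dQ expn_gt0 Q_gt0.
Qed.

Lemma torus_min_dist_anti N d d' :
  (d <= d')%N -> (torus_min_dist Q N d' <= torus_min_dist Q N d)%N.
Proof.
elim: N d d' => //= N IH d d' dd'; case: (ltnP d' Q) => d'Q.
  by rewrite (leq_ltn_trans dd' d'Q) leq_mul2r; apply/orP; right; lia.
case: (ltnP d Q) => dQ; last by apply: IH; lia.
apply: leq_trans (IH 0%N _ _) _ => //; rewrite torus_min_dist0.
by rewrite leq_pmull ?subn_gt0.
Qed.

Lemma torus_min_dist_eq1 N d : (torus_min_dist Q N d == 1%N) = (N * Q.-1 <= d)%N.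
Proof.
elim: N d => [|N IH] d //=; case: (ltnP d Q) => dQ; last by rewrite IH; lia.
rewrite muln_eq1; case: N {IH} => [|N]; first by rewrite expn0; lia.
by rewrite -{2}[1%N](exp1n N.+1) eqn_exp2r //; lia.
Qed.

Lemma subn_mul_expn_le_torus_min_dist N e d :
  (e <= Q)%N -> ((e - d) * Q ^ N <= e * torus_min_dist Q N d)%N.
Proof.
move=> eQ; case: N => [|N] /=; first by rewrite !muln1 leq_subr.
case: (ltnP d Q) => dQ; last by rewrite (_ : (e - d)%N = 0%N) ?mul0n //; lia.
by rewrite expnS !mulnA leq_mul2r; apply/orP; right; nia.
Qed.

Lemma torus_min_dist_leD N d k :
  (k < Q)%N -> (torus_min_dist Q N d <= k.+1 * torus_min_dist Q N (d + k))%N.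
Proof.
move=> kQ; elim: N d => //= N IH d; case: (ltnP (d + k) Q) => dkQ.
  by rewrite (leq_ltn_trans _ dkQ) ?leq_addr // mulnA leq_mul2r; apply/orP; right; nia.
case: (ltnP d Q) => dQ; last first.
  by rewrite -addnBAC; [exact: IH|lia].
have -> : (Q - d = k.+1 - (d + k - Q.-1))%N by lia.
exact: subn_mul_expn_le_torus_min_dist.
Qed.

Lemma torus_min_distS_le N d k :
  (k < Q)%N -> (torus_min_dist Q N.+1 (d + k) <= (Q - k) * torus_min_dist Q N d)%N.
Proof.
move=> kQ /=; case: (ltnP (d + k) Q) => dkQ.
  rewrite (_ : (Q - (d + k))%N = (Q - k - d)%N); last by lia.
  by apply: subn_mul_expn_le_torus_min_dist; rewrite leq_subr.
have -> : (Q - k = (Q.-1 - k).+1)%N by lia.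
rewrite {2}(_ : d = d + k - Q.-1 + (Q.-1 - k))%N; last by lia.
by apply: torus_min_dist_leD; lia.
Qed.
End TorusDistance.

(** * Forms on the affine torus *)

Section FiniteField.
Variable K : finFieldType.

Lemma finField_card_pred_gt0 : (0 < #|K|.-1)%N.
Proof. by rewrite -subn1 subn_gt0 card_finNzRing_gt1. Qed.

Lemma finField_expf_card_pred (c : K) : c != 0 -> c ^+ #|K|.-1 = 1.
Proof.
move=> c0; apply: (mulfI c0); rewrite -exprS mulr1 prednK ?expf_card //.
by apply/card_gt0P; exists c.
Qed.

Lemma sum_units_expr_eq0 k :
  ~~ (#|K|.-1 %| k)%N -> \sum_(c : K | c != 0) c ^+ k = 0.
Proof.
move=> Qk; have [b b0 bk] : exists2 b : K, b != 0 & b ^+ k != 1.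
  apply/exists_inP; apply: contraT; rewrite negb_exists_in => /forall_inP bk.
  have mod_gt0 : (0 < k %% #|K|.-1)%N by rewrite lt0n.
  have := ltn_pmod k finField_card_pred_gt0.
  rewrite ltnNge -{1}(cardC1 (0 : K)) cardE => /negP[].
  apply: max_unity_roots mod_gt0 _ (enum_uniq _); apply/allP=> c.
  rewrite mem_enum unity_rootE => c0; have := bk c c0; rewrite negbK.
  rewrite {1}(divn_eq k #|K|.-1) exprD mulnC exprM finField_expf_card_pred //.
  by rewrite expr1n mul1r.
apply: (mulfI (x := b ^+ k - 1)); first by rewrite subr_eq0.
rewrite mulr0 mulrBl mul1r; apply/eqP; rewrite subr_eq0; apply/eqP.
rewrite [RHS](reindex_inj (mulfI b0)) mulr_sumr.
by apply: eq_big => [c|c _]; rewrite ?mulf_eq0 ?(negPf b0) // exprMn.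
Qed.
End FiniteField.

Section CosetOperation.
Variables (K : finFieldType) (n : nat).
Implicit Types x y z : 'rV[K]_n.

Definition coset_op x y z : 'rV[K]_n := \row_i (x 0 i * y 0 i / z 0 i).

Lemma in_torus_coset_op x y z :
  in_torus x -> in_torus y -> in_torus z -> in_torus (coset_op x y z).
Proof.
move=> /forallP xt /forallP yt /forallP zt; apply/forallP=> i.
by rewrite mxE !mulf_neq0 ?invr_eq0.
Qed.

Lemma coset_opZ a b c x y z :
  coset_op (a *: x) (b *: y) (c *: z) = (a * b / c) *: coset_op x y z.
Proof. by apply/rowP=> i; rewrite !mxE invfM; ring. Qed.
End CosetOperation.

Section Fibers.
Variables (K : finFieldType) (r : nat).
Implicit Types (x y : 'rV[K]_r) (p : {mpoly K[r]}).
Implicit Types (A : {set 'rV[K]_r}) (i : 'I_r) (c : K).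

Definition nonzeros A p := [set x in A | p.@[x 0] != 0].

Lemma in_nonzeros A p x : (x \in nonzeros A p) = (x \in A) && (p.@[x 0] != 0).
Proof. by rewrite inE. Qed.

Definition values A i : {set K} := [set x 0 i | x : 'rV[K]_r in A].

Lemma mem_values A i x : x \in A -> x 0 i \in values A i.
Proof. exact: (imset_f (fun x => x 0 i)). Qed.

Definition fiber A i c := [set x in A | x 0 i == c].

Lemma fiber_sub A i c : fiber A i c \subset A.
Proof. by apply/subsetP=> x; rewrite inE => /andP []. Qed.

Lemma card_values_in A i (V : {set K}) : V \subset values A i ->
  #|[set x in A | x 0 i \in V]| = (\sum_(c in V) #|fiber A i c|)%N.
Proof.
move=> VA; rewrite -sum1_card (partition_big (fun x => x 0 i) (mem V)) /=.
  apply: eq_bigr => c cV; rewrite sum1dep_card; apply: eq_card => x.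
  by rewrite !inE -andbA; case: eqP => [->|]; rewrite ?cV ?andbF.
by move=> x; rewrite inE => /andP [].
Qed.

Lemma card_sum_fiber A i : #|A| = (\sum_(c in values A i) #|fiber A i c|)%N.
Proof.
rewrite -card_values_in //; apply: eq_card => x; rewrite inE.
by case xA: (x \in A) => //=; rewrite mem_values.
Qed.

Lemma exists_fiber_card_le A i : A != set0 ->
  exists2 c, c \in values A i & (#|values A i| * #|fiber A i c| <= #|A|)%N.
Proof.
case/set0Pn=> x xA.
case: (@arg_minnP _ (x 0 i) (mem (values A i)) (fun c => #|fiber A i c|)).
  exact: mem_values.
move=> c cV cmin; exists c => //.
by rewrite (card_sum_fiber A i) -sum_nat_const; apply: leq_sum.
Qed.

Definition separating (l : seq 'I_r) A :=
  {in A &, forall x y, {in l, forall i, x 0 i = y 0 i} -> x = y}.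

Lemma separating_fiber i l A c : separating (i :: l) A -> separating l (fiber A i c).
Proof.
move=> sep x y; rewrite !inE => /andP [xA /eqP xc] /andP [yA /eqP yc] xy.
by apply: sep => // j; rewrite inE => /predU1P [->|/xy//]; rewrite xc yc.
Qed.
End Fibers.

Section AffineTorus.
Variables (K : finFieldType) (r : nat).
Implicit Types (x y : 'rV[K]_r.+1) (p : {mpoly K[r.+1]}).
Implicit Types (A : {set 'rV[K]_r.+1}) (i : 'I_r.+1) (c : K) (vs : seq K).
Local Notation Q := #|K|.-1.

Definition affine_torus : {set 'rV[K]_r.+1} :=
  [set x | in_torus x && (x 0 0 == 1)].

Lemma affine_torus0 x : x \in affine_torus -> x 0 0 = 1.
Proof. by rewrite inE => /andP [_ /eqP]. Qed.

Lemma affine_torus_neq0 x i : x \in affine_torus -> x 0 i != 0.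
Proof. by rewrite inE => /andP [/forallP]. Qed.

Lemma scale_affine_torus x : in_torus x -> (x 0 0)^-1 *: x \in affine_torus.
Proof.
move=> /forallP xt; rewrite inE mxE mulVf // eqxx andbT; apply/forallP=> i.
by rewrite mxE mulf_neq0 ?invr_eq0.
Qed.

Definition homogenize (g : {ffun 'I_r -> K}) : 'rV[K]_r.+1 :=
  \row_i oapp g 1 (unlift 0 i).

Lemma homogenize0 g : homogenize g 0 0 = 1.
Proof. by rewrite mxE unlift_none. Qed.

Lemma homogenize_lift g j : homogenize g 0 (lift 0 j) = g j.
Proof. by rewrite mxE liftK. Qed.

Lemma homogenize_affine_torus g :
  (homogenize g \in affine_torus) = (g \in ffun_on (predC1 0)).
Proof.
rewrite inE homogenize0 eqxx andbT; apply/forallP/ffun_onP => gnz i.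
  by have := gnz (lift 0 i); rewrite homogenize_lift.
case: (unliftP 0 i) => [j|] ->; last by rewrite homogenize0 oner_neq0.
by rewrite homogenize_lift; apply: gnz.
Qed.

Lemma big_affine_torus (R : Type) (idx : R) (op : Monoid.com_law idx)
    (F : 'rV[K]_r.+1 -> R) :
  \big[op/idx]_(x in affine_torus) F x =
  \big[op/idx]_(g in ffun_on (predC1 (0 : K))) F (homogenize g).
Proof.
rewrite (reindex homogenize) /=.
  by apply: eq_bigl => g; rewrite homogenize_affine_torus.
exists (fun x => [ffun j => x 0 (lift 0 j)]) => [g _|x xT].
  by apply/ffunP=> j; rewrite ffunE homogenize_lift.
apply/rowP=> i; case: (unliftP 0 i) => [j|] ->.
  by rewrite homogenize_lift ffunE.
by rewrite homogenize0 affine_torus0.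
Qed.

Lemma card_affine_torus : #|affine_torus| = (Q ^ r)%N.
Proof.
by rewrite -sum1_card big_affine_torus sum1_card card_ffun_on cardC1 card_ord.
Qed.

(* A monomial of degree less than [r * (Q - 1)] has some exponent [m j < Q - 1],
   and the sum over the j-th coordinate vanishes. *)
Lemma sum_affine_torus_form d p : p \is d.-homog -> (d < r * Q.-1)%N ->
  \sum_(x in affine_torus) p.@[x 0] * \prod_j x 0 (lift 0 j) = 0.
Proof.
move=> /dhomogP hp dr; under eq_bigr do rewrite mevalE mulr_suml.
rewrite exchange_big /= big_seq big1 // => m /hp; rewrite /= mdegE => md.
under eq_bigr do rewrite -mulrA; rewrite -mulr_sumr big_affine_torus /=.
under eq_bigr => g _.
  rewrite big_ord_recl homogenize0 expr1n mul1r -big_split /=.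
  under eq_bigr do rewrite homogenize_lift -exprSr.
  over.
rewrite -(bigA_distr_big _ (fun (j : 'I_r) c => c ^+ (m (lift ord0 j)).+1)).
have [j mj] : exists j : 'I_r, (m (lift ord0 j) < Q.-1)%N.
  apply/existsP; apply: contraLR dr; rewrite negb_exists -leqNgt => /forallP m_ge.
  rewrite -md big_ord_recl; apply: leq_trans (leq_addl _ _).
  rewrite -[X in (X * _)%N]card_ord -sum_nat_const; apply: leq_sum => j _.
  by rewrite leqNgt.
rewrite (bigD1 j) //= sum_units_expr_eq0 ?mul0r ?mulr0 //.
by rewrite gtnNdvd //; lia.
Qed.

Lemma degree_ge_of_unique_nonzero d p :
  p \is d.-homog -> #|nonzeros affine_torus p| = 1%N -> (r * Q.-1 <= d)%N.
Proof.
move=> hp /eqP/cards1P [x nz]; rewrite leqNgt; apply/negP=> /(sum_affine_torus_form hp).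
have nzE y : (y \in affine_torus) && (p.@[y 0] != 0) = (y == x).
  by rewrite -in_nonzeros nz in_set1.
have /andP [xT px] : (x \in affine_torus) && (p.@[x 0] != 0) by rewrite nzE.
rewrite (bigD1 x) //= [X in _ + X]big1 => [|y /andP [yT /negPf yx]].
  rewrite addr0; apply/eqP; rewrite mulf_neq0 //; apply/prodf_neq0=> j _.
  exact: affine_torus_neq0.
by have := nzE y; rewrite yT yx => /negbFE/eqP ->; rewrite mul0r.
Qed.

Lemma card_values_le A i : A \subset affine_torus -> (#|values A i| <= Q)%N.
Proof.
move=> /subsetP AT; rewrite -(cardC1 (0 : K)).
apply/subset_leq_card/subsetP=> _ /imsetP [x /AT xT ->].
by rewrite inE affine_torus_neq0.
Qed.

Definition linear_factors i vs : {mpoly K[r.+1]} :=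
  \prod_(v <- vs) ('X_i - v *: 'X_0).

Lemma linear_factors_homog i vs : linear_factors i vs \is (size vs).-homog.
Proof.
rewrite /linear_factors; elim: vs => [|v vs IH]; first by rewrite big_nil dhomog1.
rewrite big_cons; apply: (@dhomogM _ _ _ 1%N) => //.
by rewrite rpredB ?rpredZ // dhomogX /= mdeg1.
Qed.

Lemma nonzeros_linear_factors A i vs p : A \subset affine_torus ->
  nonzeros A (linear_factors i vs * p) = nonzeros [set x in A | x 0 i \notin vs] p.
Proof.
move=> /subsetP AT; apply/setP=> x; rewrite !inE mevalM mulf_eq0 negb_or -andbA.
case: (boolP (x \in A)) => //= /AT /affine_torus0 x0; congr (_ && _).
rewrite /linear_factors; elim: vs => [|v vs IH].
  by rewrite big_nil meval1 oner_neq0.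
rewrite big_cons mevalM mulf_eq0 negb_or IH inE negb_or; congr (_ && _).
by rewrite mevalB mevalZ !mevalXU x0 mulr1 subr_eq0.
Qed.

Lemma exists_form_isolating_fiber A i c : A \subset affine_torus -> c \in values A i ->
  exists2 q : {mpoly K[r.+1]}, q \is (#|values A i|.-1).-homog &
    forall p, nonzeros A (q * p) = nonzeros (fiber A i c) p.
Proof.
move=> AT cV; exists (linear_factors i (enum (values A i :\ c))).
  have -> : #|values A i|.-1 = size (enum (values A i :\ c)).
    by rewrite -cardE (cardsD1 c) cV.
  exact: linear_factors_homog.
move=> p; rewrite nonzeros_linear_factors //; congr nonzeros; apply/setP=> x.
rewrite !inE mem_enum !inE; case: (boolP (x \in A)) => //= xA.
by rewrite mem_values // andbT negbK.
Qed.

(* Successively isolating the value with the smallest fibre costs [e - 1] linear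
   factors for [e] values, while the set shrinks at least [e] times. *)
Lemma exists_form_isolating_point l A :
  A \subset affine_torus -> A != set0 -> separating l A ->
  exists m d (p : {mpoly K[r.+1]}), [/\ (m + d = size l * Q.-1)%N, p \is m.-homog,
    #|nonzeros A p| = 1%N & (torus_min_dist Q (size l) d <= #|A|)%N].
Proof.
have Q0 := finField_card_pred_gt0 K.
elim: l A => [|i l IH] A AT A0 sep.
  have [x xA] := set0Pn _ A0.
  exists 0%N, 0%N, 1; rewrite dhomog1 card_gt0; split=> //.
  apply/eqP/cards1P; exists x; apply/setP=> y; rewrite !inE meval1 oner_neq0 andbT.
  by apply/idP/eqP=> [yA|->//]; apply: sep.
have [c cV small] := exists_fiber_card_le i A0.
have F0 : fiber A i c != set0.
  have /imsetP [x xA cE] := cV; apply/set0Pn; exists x.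
  by rewrite inE xA cE eqxx.
have FT := subset_trans (fiber_sub A i c) AT.
have [m [d [p [md hp p1 dF]]]] := IH _ FT F0 (separating_fiber sep).
have [q hq qE] := exists_form_isolating_fiber AT cV.
have Vgt0 : (0 < #|values A i|)%N by apply/card_gt0P; exists c.
have VQ : (#|values A i| <= Q)%N by apply: card_values_le.
set e := #|values A i| in hq small Vgt0 VQ.
exists (e.-1 + m)%N, (d + (Q - e))%N, (q * p); split.
- by rewrite [size _]/= mulSn -md; lia.
- exact: dhomogM.
- by rewrite qE.
have eQ : (Q - e < Q)%N by lia.
apply: leq_trans (torus_min_distS_le Q0 _ _ eQ) _.
by rewrite subKn // (leq_trans _ small) // leq_mul2l dF orbT.
Qed.

Theorem card_nonzeros_affine_torus_ge d p :
  p \is d.-homog -> nonzeros affine_torus p != set0 ->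
  (torus_min_dist Q r d <= #|nonzeros affine_torus p|)%N.
Proof.
move=> hp p0; pose l := [seq lift 0 j | j <- enum 'I_r] : seq 'I_r.+1.
have sl : size l = r by rewrite size_map size_enum_ord.
have nzT : nonzeros affine_torus p \subset affine_torus.
  by apply/subsetP=> x; rewrite inE => /andP [].
have [x y /(subsetP nzT) xT /(subsetP nzT) yT xy|m [e [q []]]] :=
    @exists_form_isolating_point l _ nzT p0.
  apply/rowP=> i; case: (unliftP 0 i) => [j|] ->; last by rewrite !affine_torus0.
  by apply: xy; rewrite map_f ?mem_enum.
rewrite sl => me hq q1; apply: leq_trans; apply: torus_min_dist_anti.
  exact: finField_card_pred_gt0.
have := degree_ge_of_unique_nonzero (dhomogM hq hp).
rewrite -leq_subLR -me addKn; apply.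
rewrite -[RHS]q1; apply: eq_card => x; rewrite !in_nonzeros mevalM mulf_eq0 negb_or.
by rewrite -andbA [X in _ = _ && X]andbC.
Qed.

Definition is_coset A := {in A & &, forall x y z, coset_op x y z \in A}.

Lemma is_coset_fiber A i c :
  A \subset affine_torus -> is_coset A -> is_coset (fiber A i c).
Proof.
move=> /subsetP AT cA x y z; rewrite !inE.
move=> /andP [xA /eqP xc] /andP [yA /eqP yc] /andP [zA /eqP zc].
rewrite cA // mxE xc yc zc mulfK //= -zc; exact/affine_torus_neq0/AT.
Qed.

Section Coset.
Variable A : {set 'rV[K]_r.+1}.
Hypotheses (AT : A \subset affine_torus) (cA : is_coset A).

Lemma card_fiber_coset i :
  {in values A i &, forall c c', #|fiber A i c| = #|fiber A i c'|}.
Proof.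
suff fiber_le : {in values A i &, forall c c', (#|fiber A i c| <= #|fiber A i c'|)%N}.
  by move=> c c' cV cV'; apply/eqP; rewrite eqn_leq !fiber_le.
move=> _ _ /imsetP [x xA ->] /imsetP [y yA ->].
have nz u : u \in A -> forall j, u 0 j != 0.
  by move=> uA j; apply/affine_torus_neq0/(subsetP AT).
rewrite -(card_imset (f := fun z => coset_op z y x)) => [|z z' /rowP e]; last first.
  apply/rowP=> j; have := e j; rewrite !mxE => /divIf/mulIf; apply; exact: nz.
apply/subset_leq_card/subsetP=> _ /imsetP [z + ->]; rewrite !inE => /andP [zA /eqP zx].
by rewrite cA // mxE zx mulrAC divff ?nz // mul1r eqxx.
Qed.

Lemma card_values_in_coset i c (V : {set K}) :
  c \in values A i -> V \subset values A i ->
  #|[set x in A | x 0 i \in V]| = (#|V| * #|fiber A i c|)%N.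
Proof.
move=> cV VA; rewrite card_values_in // -sum_nat_const.
by apply: eq_bigr => c' /(subsetP VA) c'V; apply: card_fiber_coset.
Qed.

Lemma card_coset_fiber i c :
  c \in values A i -> #|A| = (#|values A i| * #|fiber A i c|)%N.
Proof.
move=> cV; rewrite (card_sum_fiber A i) -sum_nat_const.
by apply: eq_bigr => c' c'V; apply: card_fiber_coset.
Qed.

Lemma exists_form_avoiding_values i x d : x \in A -> (d < #|values A i|)%N ->
  exists p : {mpoly K[r.+1]}, [/\ p \is d.-homog, x \in nonzeros A p &
    #|nonzeros A p| * #|values A i| = (#|values A i| - d) * #|A|]%N.
Proof.
move=> xA dV; have xV : x 0 i \in values A i by apply: mem_values.
have /card_geqP [vs [uvs sz vsV]] : (d <= #|values A i :\ x ord0 i|)%N.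
  by move: dV; rewrite (cardsD1 (x 0 i)) xV.
have vs_values : [set:: vs] \subset values A i.
  by apply/subsetP=> v; rewrite inE => /vsV; rewrite inE => /andP [].
have nzE : nonzeros A (linear_factors i vs) =
    [set y in A | y 0 i \in values A i :\: [set:: vs]].
  rewrite -[linear_factors i vs]mulr1 nonzeros_linear_factors //.
  apply/setP=> y; rewrite !inE meval1 oner_neq0 andbT.
  by case: (boolP (y \in A)) => //= yA; rewrite mem_values // andbT.
exists (linear_factors i vs); split; first by rewrite -sz linear_factors_homog.
  rewrite nzE !inE xA xV andbT; apply: contraTN isT => /vsV.
  by rewrite !inE eqxx.
rewrite nzE (card_values_in_coset xV) ?subsetDl // cardsDS //.
rewrite (_ : #|[set:: vs]| = d); first by rewrite (card_coset_fiber xV); lia.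
by rewrite cardsE; move/card_uniqP: uvs => ->.
Qed.
End Coset.

(* All fibres of a coordinate on a coset have the same size, so killing all but
   one of its [e] values divides the number of nonzeros by exactly [e]. *)
Lemma exists_form_few_nonzeros N l A x d :
  A \subset affine_torus -> is_coset A -> separating l A -> x \in A ->
  exists p : {mpoly K[r.+1]}, [/\ p \is d.-homog, x \in nonzeros A p &
    (#|nonzeros A p| <= 1) ||
    (#|nonzeros A p| * Q ^ N <= #|A| * torus_min_dist Q N d)]%N.
Proof.
have Q0 := finField_card_pred_gt0 K.
elim: l A d => [|i l IH] A d AT cA sep xA.
  exists ('X_0 ^+ d); split.
  - by rewrite -[d in d.-homog]mul1n dhomogMn // dhomogX /= mdeg1.
  - rewrite in_nonzeros xA rmorphXn /= mevalXU affine_torus0 ?(subsetP AT) //.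
    by rewrite expr1n oner_neq0.
  apply/orP; left; apply/card_le1_eqP => y z; rewrite !inE.
  by move=> /andP [yA _] /andP [zA _]; apply: sep.
have xV : x 0 i \in values A i by apply: mem_values.
have AE := card_coset_fiber AT cA xV.
have VQ := card_values_le i AT; set e := #|values A i| in AE VQ *.
have [de|ed] := ltnP d e.
  have [p [hp px pA]] := exists_form_avoiding_values AT cA xA de.
  exists p; split=> //; apply/orP; right.
  rewrite -(leq_pmul2l (leq_ltn_trans _ de)) //.
  rewrite mulnA (mulnC e) pA mulnAC mulnC [leqRHS]mulnCA leq_mul2l.
  by rewrite (subn_mul_expn_le_torus_min_dist Q0) ?orbT.
have [q hq qE] := exists_form_isolating_fiber AT xV.
have [||||p [hp px pw]] := IH (fiber A i (x 0 i)) (d - e.-1)%N.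
- exact: subset_trans (fiber_sub _ _ _) AT.
- exact: is_coset_fiber.
- exact: separating_fiber.
- by rewrite inE xA eqxx.
exists (q * p); rewrite qE; split=> //.
  by rewrite (_ : d = e.-1 + (d - e.-1))%N; [exact: dhomogM|lia].
case/orP: pw => [->//|pw]; apply/orP; right; apply: leq_trans pw _.
rewrite AE mulnAC mulnC leq_mul2r; apply/orP; right.
have e0 : (0 < e)%N by apply/card_gt0P; exists (x 0 i).
have eQ : (e.-1 < Q)%N by rewrite prednK.
have := torus_min_dist_leD Q0 N (d - e.-1) eQ.
by rewrite prednK // subnK // (leq_trans (leq_pred e)).
Qed.

Corollary exists_form_card_nonzeros_le N A x d :
  A \subset affine_torus -> is_coset A -> #|A| = (Q ^ N)%N -> x \in A ->
  exists p : {mpoly K[r.+1]}, [/\ p \is d.-homog, x \in nonzeros A p &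
    (#|nonzeros A p| <= torus_min_dist Q N d)%N].
Proof.
move=> AT cA AE xA; have sepA : separating (enum 'I_r.+1) A.
  by move=> y z _ _ yz; apply/rowP=> i; apply: yz; rewrite mem_enum.
have [p [hp px pw]] := exists_form_few_nonzeros N d AT cA sepA xA.
exists p; split=> //; case/orP: pw => [p_le1|].
  by apply: leq_trans p_le1 _; apply/torus_min_dist_gt0/finField_card_pred_gt0.
by rewrite AE mulnC leq_pmul2l // expn_gt0 finField_card_pred_gt0.
Qed.

Lemma affine_torus_coset : is_coset affine_torus.
Proof.
move=> x y z; rewrite !inE => /andP [xt /eqP x0] /andP [yt /eqP y0] /andP [zt /eqP z0].
by rewrite in_torus_coset_op // mxE x0 y0 z0 mulr1 divr1 eqxx.
Qed.
End AffineTorus.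

(** * Evaluation codes *)

Section ProjectivePoints.
Variables (K : finFieldType) (r : nat).
Implicit Type P : 'rV[K]_r.

Lemma pclassZ c P : c != 0 -> pclass (c *: P) = pclass P.
Proof.
move=> c0; apply/setP=> y; apply/imsetP/imsetP => -[b]; rewrite inE => b0 ->.
  by exists (b * c); rewrite ?inE ?mulf_neq0 // scalerA.
by exists (b / c); rewrite ?inE ?mulf_neq0 ?invr_eq0 // scalerA divfK.
Qed.

Lemma pclass_eq_scale P P' : pclass P = pclass P' -> exists2 c, c != 0 & P = c *: P'.
Proof.
move=> PP'; have : P \in pclass P'.
  by rewrite -PP'; apply/imsetP; exists 1; rewrite ?scale1r // inE oner_neq0.
by case/imsetP=> c; rewrite inE => c0 ->; exists c.
Qed.

Lemma rep_pclass P : exists2 c, c != 0 & rep (pclass P) = c *: P.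
Proof.
rewrite /rep; case: pickP => [x /imsetP [c]|/(_ P)].
  by rewrite inE => c0 ->; exists c.
by move/negP; case; apply/imsetP; exists 1; rewrite ?scale1r // inE oner_neq0.
Qed.

Definition normalized_rep (p : {set 'rV[K]_r}) : 'rV[K]_r :=
  (fcoord (rep p))^-1 *: rep p.
End ProjectivePoints.

Section AffinePoints.
Variables (K : finFieldType) (r : nat).
Implicit Types (P : 'rV[K]_r.+1) (Y : {set {set 'rV[K]_r.+1}}).
Local Notation T := (proj_torus K r.+1).

Lemma fcoordE P : fcoord P = P 0 0.
Proof. by rewrite /fcoord enum_ordSl. Qed.

Lemma proj_torusE : T = [set pclass x | x in affine_torus K r].
Proof.
apply/setP=> p; apply/imsetP/imsetP => -[x]; rewrite inE; last first.
  by case/andP=> xT _ ->; exists x; rewrite ?inE.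
move=> xt ->; exists ((x 0 0)^-1 *: x); first exact: scale_affine_torus.
by rewrite pclassZ // invr_eq0; move/forallP: xt.
Qed.

Lemma normalized_rep_pclass P :
  P 0 0 != 0 -> normalized_rep (pclass P) = (P 0 0)^-1 *: P.
Proof.
move=> P0; rewrite /normalized_rep; have [c c0 ->] := rep_pclass P.
by rewrite fcoordE mxE scalerA invfM mulrAC mulVf // mul1r.
Qed.

Lemma pclassK : {in affine_torus K r, cancel (@pclass K _) (@normalized_rep K _)}.
Proof.
move=> x /affine_torus0 x0.
by rewrite normalized_rep_pclass x0 ?oner_neq0 // invr1 scale1r.
Qed.

Lemma normalized_rep_inj : {in T &, injective (@normalized_rep K _)}.
Proof.
rewrite proj_torusE => _ _ /imsetP [x xT ->] /imsetP [y yT ->].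
by rewrite !pclassK // => ->.
Qed.

Lemma fcoord_rep_neq0 p : p \in T -> fcoord (rep p) != 0.
Proof.
case/imsetP=> x; rewrite inE => /forallP xT ->.
by have [c c0 ->] := rep_pclass x; rewrite fcoordE mxE mulf_neq0.
Qed.

Definition affine_points Y := [set normalized_rep p | p in Y].

Lemma affine_points_proj_torus : affine_points T = affine_torus K r.
Proof.
rewrite proj_torusE /affine_points -imset_comp -[RHS]imset_id.
by apply: eq_in_imset => x xT /=; rewrite pclassK.
Qed.

Lemma affine_points_sub Y : Y \subset T -> affine_points Y \subset affine_torus K r.
Proof. by rewrite -affine_points_proj_torus; apply: imsetS. Qed.

Lemma card_affine_points Y : Y \subset T -> #|affine_points Y| = #|Y|.
Proof.
move=> /subsetP YT; apply: card_in_imset => p p' /YT pT /YT.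
exact: normalized_rep_inj.
Qed.

Lemma card_proj_torus : #|T| = (#|K|.-1 ^ r)%N.
Proof.
by rewrite -card_affine_points // affine_points_proj_torus card_affine_torus.
Qed.
End AffinePoints.

Section Codes.
Variable K : finFieldType.

Lemma hweight_gt0 m (v : 'rV[K]_m) : (0 < hweight v)%N = (v != 0).
Proof. by apply/card_gt0P/rV0Pn => -[j vj]; exists j; rewrite inE in vj *. Qed.

Lemma hweight_delta m (j : 'I_m) : hweight (delta_mx 0 j : 'rV[K]_m) = 1%N.
Proof.
apply/eqP/cards1P; exists j; apply/setP=> k; rewrite !inE mxE eqxx /=.
by case: (k == j); rewrite ?oner_neq0 ?eqxx.
Qed.

Lemma row_full_of_hweight1 n m (C : 'M[K]_(n, m)) :
  (forall j, exists v : 'rV[K]_m, [/\ (v <= C)%MS, v 0 j != 0 & (hweight v <= 1)%N]) ->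
  row_full C.
Proof.
move=> light; rewrite -sub1mx; apply/row_subP=> j; rewrite row1.
have [v [vC vj /card_le1_eqP v1]] := light j.
have -> : delta_mx 0 j = (v 0 j)^-1 *: v.
  apply/rowP=> k; rewrite !mxE eqxx /=.
  have [->|kj] := eqVneq k j; first by rewrite mulVf.
  have [->|vk] := eqVneq (v 0 k) 0; first by rewrite mulr0.
  by case/eqP: kj; apply: v1; rewrite inE.
exact: scalemx_sub.
Qed.

Lemma min_dist_le r (Y : {set {set 'rV[K]_r}}) d v :
  v != 0 -> (v <= code_mx Y d)%MS -> (min_dist Y d <= hweight v)%N.
Proof.
move=> v0 vC; rewrite /min_dist -minEnat.
by apply: (bigmin_le_cond _ (@hweight K _)); rewrite v0.
Qed.

Lemma min_dist_ge r (Y : {set {set 'rV[K]_r}}) d m : (m <= #|Y|)%N ->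
  (forall v, v != 0 -> (v <= code_mx Y d)%MS -> (m <= hweight v)%N) ->
  (m <= min_dist Y d)%N.
Proof.
move=> mY mv; rewrite /min_dist -minEnat -leEnat.
by apply: le_bigmin => // v /andP [v0 vC]; apply: mv.
Qed.

Lemma exists_is_reg_le r (Y : {set {set 'rV[K]_r}}) D :
  (forall d, (D <= d)%N -> hilb Y d = #|Y|) -> exists2 p, is_reg Y p & (p <= D)%N.
Proof.
move=> hilbD; pose P p := [forall d : 'I_D, (p <= d)%N ==> (hilb Y d == #|Y|)].
have exP : exists p, P p by exists D; apply/forallP=> d; rewrite leqNgt ltn_ord.
case: (ex_minnP exP) => p /forallP Pp pmin; exists p.
  split=> [d pd|p' hilbp']; last first.
    by apply: pmin; apply/forallP=> d; apply/implyP=> /hilbp' ->.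
  case: (ltnP d D) => [dD|]; last exact: hilbD.
  by have := Pp (Ordinal dD); rewrite /= pd => /eqP.
by apply: pmin; apply/forallP=> d; rewrite leqNgt ltn_ord.
Qed.
End Codes.

Section Codewords.
Variables (K : finFieldType) (r : nat).
Implicit Type Y : {set {set 'rV[K]_r}}.

Definition codeword Y (p : {mpoly K[r]}) : 'rV[K]_#|Y| :=
  \row_j p.@[normalized_rep (enum_val j) 0].

Lemma code_mxE Y d i j :
  code_mx Y d i j = mon_eval (enum_val i) (normalized_rep (enum_val j)).
Proof.
have := enum_valP i; rewrite mxE inE /normalized_rep => /eqP id.
rewrite /mon_eval; under [RHS]eq_bigr do rewrite mxE exprMn.
by rewrite big_split /= prodrXr id exprVn mulrC.
Qed.

Definition mons_mnm d (a : {ffun 'I_r -> 'I_d.+1}) : 'X_{1..r} :=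
  [multinom (a i : nat) | i < r].

Lemma meval_mons_mnm d (a : {ffun 'I_r -> 'I_d.+1}) (P : 'rV[K]_r) :
  'X_[mons_mnm a].@[P 0] = mon_eval a P.
Proof. by rewrite mevalX; apply: eq_bigr => i _; rewrite mnmE. Qed.

Lemma mdeg_mons_mnm d (a : {ffun 'I_r -> 'I_d.+1}) :
  (mdeg (mons_mnm a) == d) = (a \in mons r d).
Proof. by rewrite inE mdegE; congr (_ == _); apply: eq_bigr => i _; rewrite mnmE. Qed.

Lemma mons_mnm_surj (m : 'X_{1..r}) :
  exists2 a, a \in mons r (mdeg m) & mons_mnm a = m.
Proof.
pose a : {ffun 'I_r -> 'I_(mdeg m).+1} := [ffun i => inord (m i)].
have aE : mons_mnm a = m.
  apply/mnmP=> i; rewrite mnmE ffunE inordK // ltnS mdegE.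
  by rewrite (bigD1 i) //= leq_addr.
by exists a; rewrite // -mdeg_mons_mnm aE.
Qed.

Lemma code_mxP Y d v :
  reflect (exists2 p : {mpoly K[r]}, p \is d.-homog & v = codeword Y p)
    (v <= code_mx Y d)%MS.
Proof.
apply: (iffP idP) => [/submxP [u ->]|[p /dhomogP hp ->]].
  exists (\sum_i u 0 i *: 'X_[mons_mnm (enum_val i)]).
    by apply: rpred_sum => i _; rewrite rpredZ // dhomogX /= mdeg_mons_mnm enum_valP.
  apply/rowP=> j; rewrite !mxE raddf_sum; apply: eq_bigr => i _.
  by rewrite /= mevalZ meval_mons_mnm code_mxE.
have -> : codeword Y p = \sum_(m <- msupp p) p@_m *: codeword Y 'X_[m].
  apply/rowP=> j; rewrite mxE mevalE summxE; apply: eq_bigr => m _.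
  by rewrite !mxE mevalX.
rewrite big_seq; apply: summx_sub => m /hp md; apply: scalemx_sub.
have [a] := mons_mnm_surj m; move: a; rewrite md => a am <-.
rewrite (_ : codeword _ _ = row (enum_rank_in am a) (code_mx Y d)) ?row_sub //.
by apply/rowP=> j; rewrite mxE [RHS]mxE code_mxE enum_rankK_in // meval_mons_mnm.
Qed.
End Codewords.

Section TorusSubsetCodes.
Variables (K : finFieldType) (r : nat) (Y : {set {set 'rV[K]_r.+1}}).
Hypothesis YT : Y \subset proj_torus K r.+1.

Lemma hweight_codeword (p : {mpoly K[r.+1]}) :
  hweight (codeword Y p) = #|nonzeros (affine_points Y) p|.
Proof.
have /subsetP YsubT := YT; pose pt (j : 'I_#|Y|) := normalized_rep (enum_val j).
have ptI : injective pt.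
  move=> j k jk; apply/enum_val_inj/normalized_rep_inj => //; exact/YsubT/enum_valP.
rewrite /hweight -(card_imset _ ptI); apply: eq_card => x; rewrite in_nonzeros.
apply/imsetP/andP => [[j + ->]|[/imsetP [y yY ->] py]].
  by rewrite inE mxE => pj; split=> //; apply/imset_f/enum_valP.
by exists (enum_rank_in yY y); rewrite ?inE ?mxE /pt enum_rankK_in.
Qed.

Lemma hilbE d : hilb Y d = \rank (code_mx Y d).
Proof.
rewrite /hilb mxrank_ker subKn ?rank_leq_row //.
pose D : 'rV[K]_#|Y| := \row_j (fcoord (rep (enum_val j)) ^+ d)^-1.
have -> : code_mx Y d = eval_mx Y d *m diag_mx D.
  by apply/matrixP=> i j; rewrite mul_mx_diag !mxE.
rewrite mxrankMfree // row_free_unit unitmxE det_diag unitfE.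
apply/prodf_neq0 => j _; rewrite mxE invr_eq0 expf_neq0 //.
exact/fcoord_rep_neq0/(subsetP YT)/enum_valP.
Qed.
End TorusSubsetCodes.

Section CosetCodes.
Variables (K : finFieldType) (r N : nat) (Y : {set {set 'rV[K]_r.+1}}).
Hypothesis YT : Y \subset proj_torus K r.+1.
Hypothesis cosetY : is_coset (affine_points Y).
Hypothesis cardY : #|Y| = (#|K|.-1 ^ N)%N.
Local Notation Q := #|K|.-1.

Lemma coset_codeword j d : exists v : 'rV[K]_#|Y|,
  [/\ (v <= code_mx Y d)%MS, v 0 j != 0 & (hweight v <= torus_min_dist Q N d)%N].
Proof.
have AE : #|affine_points Y| = (Q ^ N)%N by rewrite card_affine_points.
have jY : normalized_rep (enum_val j) \in affine_points Y by apply/imset_f/enum_valP.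
have [p [hp]] := exists_form_card_nonzeros_le d (affine_points_sub YT) cosetY AE jY.
rewrite in_nonzeros -hweight_codeword // => /andP [_ pj] pw.
by exists (codeword Y p); rewrite mxE; split=> //; apply/code_mxP; exists p.
Qed.

Lemma min_dist_coset d : (min_dist Y d <= torus_min_dist Q N d)%N.
Proof.
have Y0 : (0 < #|Y|)%N by rewrite cardY expn_gt0 finField_card_pred_gt0.
have [v [vC vj vw]] := coset_codeword (Ordinal Y0) d.
apply: leq_trans (min_dist_le _ vC) vw.
by apply: contraNneq vj => ->; rewrite mxE.
Qed.

Lemma hilb_coset d : (N * Q.-1 <= d)%N -> hilb Y d = #|Y|.
Proof.
rewrite -torus_min_dist_eq1 ?finField_card_pred_gt0 // => /eqP d1.
rewrite hilbE //; apply/eqP/row_full_of_hweight1 => j.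
by have := coset_codeword j d; rewrite d1.
Qed.
End CosetCodes.

Section TorusCodes.
Variables (K : finFieldType) (r : nat).
Local Notation T := (proj_torus K r.+1).
Local Notation Q := #|K|.-1.

Lemma affine_points_torus_coset : is_coset (affine_points T).
Proof. by rewrite affine_points_proj_torus; apply: affine_torus_coset. Qed.

Lemma torus_hweight_ge d (v : 'rV[K]_#|T|) : v != 0 -> (v <= code_mx T d)%MS ->
  (torus_min_dist Q r d <= hweight v)%N.
Proof.
move=> + /code_mxP [p hp vE]; rewrite -hweight_gt0 vE hweight_codeword //.
by rewrite affine_points_proj_torus card_gt0; apply: card_nonzeros_affine_torus_ge.
Qed.

Lemma min_dist_proj_torus d : min_dist T d = torus_min_dist Q r d.
Proof.
have Q0 := finField_card_pred_gt0 K; apply/eqP; rewrite eqn_leq.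
rewrite min_dist_coset ?card_proj_torus //; last exact: affine_points_torus_coset.
apply: min_dist_ge; last exact: torus_hweight_ge.
by rewrite card_proj_torus -(torus_min_dist0 Q0) torus_min_dist_anti.
Qed.

Lemma hilb_proj_torus d : (hilb T d == #|T|) = (r * Q.-1 <= d)%N.
Proof.
have Q0 := finField_card_pred_gt0 K; apply/idP/idP => [|rd]; last first.
  apply/eqP; apply: hilb_coset rd => //; first exact: affine_points_torus_coset.
  exact: card_proj_torus.
rewrite hilbE // -(torus_min_dist_eq1 Q0) => full.
have T0 : (0 < #|T|)%N by rewrite card_proj_torus expn_gt0 Q0.
rewrite eqn_leq torus_min_dist_gt0 // andbT -(hweight_delta K (Ordinal T0)).
by apply: torus_hweight_ge; [rewrite -hweight_gt0 hweight_delta|exact: submx_full].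
Qed.

Theorem is_reg_proj_torus : is_reg T (r * Q.-1).
Proof.
split=> [d|p hilbp]; first by rewrite -hilb_proj_torus => /eqP.
by rewrite -hilb_proj_torus hilbp.
Qed.
End TorusCodes.

(** * Normal edge ideals *)

Lemma sum_count_mem (I : finType) (js : seq I) (F : I -> nat) :
  (\sum_(j <- js) F j = \sum_i count_mem i js * F i)%N.
Proof.
elim: js => [|j js IH]; first by rewrite big_nil big1.
rewrite big_cons IH; under [RHS]eq_bigr do rewrite /= mulnDl.
rewrite big_split /=; congr (_ + _)%N; rewrite (bigD1 j) //= eqxx mul1n.
by rewrite big1 ?addn0 // => i /negPf; rewrite eq_sym => ->.
Qed.

Lemma sum_eq_op (I : finType) (x : I) : (\sum_i (i == x) = 1)%N.
Proof. by rewrite (bigD1 x) //= eqxx big1 // => i /negPf ->. Qed.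

Lemma rat_col_scale s (u : 'cV[rat]_s) :
  exists2 p : nat, (0 < p)%N &
    exists c : 'I_s -> int, forall i, (c i)%:~R = p%:R * u i 0.
Proof.
have [q [a a0 uE]] := rat_poly_scale (rVpoly u^T).
exists `|a|%N; first by rewrite absz_gt0.
exists (fun i : 'I_s => sgz a * q`_i) => i.
have := coef_rVpoly_ord u^T i; rewrite uE coefZ coef_map_id0 // mxE => <-.
by rewrite pmulrn abszEsg !intrM -[RHS]mulrA mulVKf ?intr_eq0.
Qed.

Lemma rat_col_scale_nat s (u : 'cV[rat]_s) :
  exists p M (m : 'I_s -> nat), (0 < p)%N /\
    forall i, (m i)%:R = p%:R * (M%:R + u i 0).
Proof.
have [p p0 [c hc]] := rat_col_scale u.
pose M := (\sum_i `|c i|)%N.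
exists p, M, (fun i => absz ((p * M)%N%:Z + c i)); split=> // i.
rewrite mulrDr -natrM -hc pmulrn gez0_abs ?intrD // -[X in X <= _]/(0%:Z).
have : (`|c i| <= M)%N by rewrite /M (bigD1 i) //= leq_addr.
have : (M <= p * M)%N by rewrite leq_pmull.
lia.
Qed.

Section Clutter.
Variables (n s : nat) (f : 'I_s -> {set 'I_n}).
Implicit Types (m : 'I_s -> nat) (a b k : 'I_n).

Definition edge_sum m k : nat := (\sum_i m i * charv f i k)%N.

Lemma mon_in_powP i (e : 'I_n -> nat) : mon_in_pow f i e <->
  exists2 m, (\sum_j m j = i)%N & forall k, (edge_sum m k <= e k)%N.
Proof.
split=> [[js le_e]|[m mi le_e]].
  exists (fun j => count_mem j js) => [|k]; last by rewrite /edge_sum -sum_count_mem.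
  rewrite -[RHS](size_tuple js) -sum1_size [RHS]sum_count_mem.
  by apply: eq_bigr => j _; rewrite muln1.
pose js := flatten [seq nseq (m j) j | j <- enum 'I_s].
have sum_js (F : 'I_s -> nat) : (\sum_(j <- js) F j = \sum_j m j * F j)%N.
  rewrite big_flatten big_map big_enum; apply: eq_bigr => j _.
  by rewrite big_nseq iter_addn_0 mulnC.
have sz_js : size js == i.
  by rewrite -sum1_size sum_js -mi; apply/eqP/eq_bigr => j _; rewrite muln1.
by exists (Tuple sz_js) => k; rewrite sum_js; apply: le_e.
Qed.

Lemma edge_sumMl c m k : edge_sum (fun i => c * m i)%N k = (c * edge_sum m k)%N.
Proof. by rewrite /edge_sum big_distrr; apply: eq_bigr => i _; rewrite /= mulnA. Qed.

Lemma natr_edge_sum m k :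
  (edge_sum m k)%:R = (incidence_mx f *m \col_i (m i)%:R) k 0 :> rat.
Proof. by rewrite natr_sum mxE; apply: eq_bigr => i _; rewrite !mxE natrM mulrC. Qed.

Lemma prod_edge_sum (R : comNzRingType) (z : 'I_n -> R) m :
  \prod_k z k ^+ edge_sum m k = \prod_i (\prod_(k in f i) z k) ^+ m i.
Proof.
under eq_bigr do rewrite /edge_sum -prodrXr.
rewrite exchange_big; apply: eq_bigr => i _ /=; rewrite -prodrXl [RHS]big_mkcond.
by apply: eq_bigr => k _; rewrite /charv; case: (k \in f i); rewrite ?muln1 ?muln0.
Qed.

Section Uniform.
Variable w : nat.
Hypotheses (unif : forall i, #|f i| = w) (w_gt0 : (0 < w)%N).

Lemma sum_edge_sum m : (\sum_k edge_sum m k = w * \sum_i m i)%N.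
Proof.
rewrite exchange_big big_distrr; apply: eq_bigr => i _ /=.
rewrite -big_distrr /= mulnC -(unif i) -sum1_card [\sum_(k in f i) _]big_mkcond.
by congr muln; apply: eq_bigr => k _; rewrite /charv; case: (k \in f i).
Qed.

Lemma sum_edge_sumD m p a :
  (\sum_k (edge_sum m k + p * (k == a)) = w * (\sum_i m i) + p)%N.
Proof. by rewrite big_split /= sum_edge_sum -big_distrr /= sum_eq_op muln1. Qed.

Lemma sum_of_exchange m m' p a b :
  (forall k, edge_sum m k + p * (k == b) = edge_sum m' k + p * (k == a))%N ->
  (\sum_i m i = \sum_i m' i)%N.
Proof.
move=> mm'; apply/eqP; rewrite -(eqn_pmul2l w_gt0) -(eqn_add2r p).
by rewrite -(sum_edge_sumD m p b) -(sum_edge_sumD m' p a); apply/eqP/eq_bigr.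
Qed.

Hypothesis rk : \rank (incidence_mx f) = n.

Lemma scaled_exchange a b : exists p M m, (0 < p)%N /\
  forall k, (edge_sum m k + p * (k == b) = p * edge_sum (fun=> M) k + p * (k == a))%N.
Proof.
have fr : row_free (incidence_mx f) by rewrite /row_free rk.
pose v : 'cV[rat]_n := delta_mx a 0 - delta_mx b 0.
have [u uE] : exists u, incidence_mx f *m u = v.
  by exists (pinvmx (incidence_mx f) *m v); rewrite mulmxA mulmxVp // mul1mx.
have [p [M [m [p0 mE]]]] := rat_col_scale_nat u; exists p, M, m; split=> // k.
apply/eqP; rewrite -(eqr_nat rat) !(natrD, natrM) !natr_edge_sum.
have -> : \col_i (m i)%:R = p%:R *: (\col_i M%:R + u).
  by apply/colP=> i; rewrite !mxE mE.
rewrite -scalemxAr mulmxDr uE; set x := incidence_mx f *m _.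
by rewrite !mxE eqxx !andbT; apply/eqP; ring.
Qed.

Hypothesis nrm : edge_ideal_normal f.

(* The monomial [M * (v_1 + ... + v_s) + e_a - e_b] has a power in the corresponding
   power of the ideal; by normality it is divisible by a product of [M * s]
   generators, and it is equal to it because the degrees agree. *)
Lemma exchange_of_normal a b : a != b -> exists M m, forall k,
  (edge_sum m k + (k == b) = edge_sum (fun=> M) k + (k == a))%N.
Proof.
move=> ab; have [p [M [m [p0 pE]]]] := scaled_exchange a b.
have Mb : (0 < edge_sum (fun=> M) b)%N.
  have := pE b; rewrite eqxx eq_sym (negPf ab); case: posnP => // ->; lia.
have sM : (\sum_(i < s) M = M * s)%N by rewrite sum_nat_const card_ord mulnC.
have Ms : (0 < M * s)%N.
  rewrite lt0n; apply: contraTneq Mb => Ms0.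
  rewrite -leqNgt -[leqRHS](muln0 w) -Ms0 -sM -sum_edge_sum.
  by rewrite (bigD1 b) //= leq_addr.
pose W k := (edge_sum (fun=> M) k + (k == a) - (k == b))%N.
have WE k : (W k + (k == b) = edge_sum (fun=> M) k + (k == a))%N.
  by rewrite subnK //; case: eqP => // ->; lia.
have mM : (\sum_i m i = p * (M * s))%N.
  rewrite (@sum_of_exchange _ (fun=> p * M)%N p a b) => [|k].
    by rewrite -big_distrr sM.
  by rewrite edge_sumMl pE.
have /mon_in_powP [m' m'M le_W] : mon_in_pow f (M * s) W.
  apply: nrm => //; exists p; split=> //; apply/mon_in_powP; exists m => // k.
  by rewrite -(leq_add2r (p * (k == b))) pE -!mulnDr WE.
have sumW : (\sum_k edge_sum m' k == \sum_k W k)%N.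
  rewrite -(eqn_add2r 1) -{2}(sum_eq_op b) -big_split /=.
  under [X in _ == X]eq_bigr do rewrite WE.
  by rewrite big_split /= sum_eq_op !sum_edge_sum m'M sM.
exists M, m' => k; rewrite -WE; congr (_ + _)%N; apply/eqP.
have [|_] := @leqif_sum _ predT (fun k => edge_sum m' k == W k) (edge_sum m') W.
  by move=> k' _; split.
by rewrite sumW => /esym/forallP/(_ k).
Qed.

Lemma constant_of_normal (F : fieldType) (z : 'I_n -> F) c :
  (forall k, z k != 0) -> (forall i, \prod_(k in f i) z k = c) ->
  forall a b, z a = z b.
Proof.
move=> z0 zc a b; have [->//|ab] := eqVneq a b.
have [M [m mE]] := exchange_of_normal ab.
have zx x : \prod_k z k ^+ (k == x) = z x.
  by rewrite (bigD1 x) //= eqxx big1 ?mulr1 // => k /negPf ->.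
have zsum m' x : \prod_k z k ^+ (edge_sum m' k + (k == x)) = c ^+ (\sum_i m' i) * z x.
  under eq_bigr do rewrite exprD; rewrite big_split /= zx prod_edge_sum; congr (_ * _).
  by under eq_bigr do rewrite zc; rewrite prodrXr.
have mM : (\sum_i m i = \sum_(i < s) M)%N.
  by apply: (@sum_of_exchange _ _ 1 a b) => k; rewrite !mul1n.
have := zsum m b; under eq_bigr do rewrite mE; rewrite zsum mM => /mulfI -> //.
have : c ^+ (\sum_(i < s) M) * z b != 0.
  by rewrite -mM -zsum; apply/prodf_neq0=> k _; rewrite expf_neq0.
by rewrite mulf_eq0 negb_or => /andP [].
Qed.
End Uniform.
End Clutter.

(** * Parameterized sets *)

Section ParamSet.
Variables (K : finFieldType) (n s : nat) (f : 'I_s.+1 -> {set 'I_n}).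
Implicit Types x y z : 'rV[K]_n.
Local Notation X := (param_set K f).

Lemma in_torus_param_point x : in_torus x -> in_torus (param_point f x).
Proof. by move=> /forallP xt; apply/forallP=> i; rewrite mxE; apply/prodf_neq0. Qed.

Lemma param_set_sub : X \subset proj_torus K s.+1.
Proof.
apply/subsetP=> _ /imsetP [x + ->]; rewrite inE => xt.
by apply/imset_f; rewrite inE in_torus_param_point.
Qed.

Lemma param_point_coset_op x y z :
  param_point f (coset_op x y z) =
  coset_op (param_point f x) (param_point f y) (param_point f z).
Proof.
apply/rowP=> i; rewrite !mxE -big_split -prodf_div.
by apply: eq_bigr => k _; rewrite mxE.
Qed.

Lemma affine_points_param_set_coset : is_coset (affine_points X).
Proof.
have repE x : in_torus x -> normalized_rep (pclass (param_point f x)) =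
    (param_point f x 0 0)^-1 *: param_point f x.
  by move/in_torus_param_point/forallP=> xt; rewrite normalized_rep_pclass.
have repP p : p \in affine_points X -> exists2 x, in_torus x &
    p = (param_point f x 0 0)^-1 *: param_point f x.
  by case/imsetP=> _ /imsetP [x + ->] ->; rewrite inE => xt; exists x; rewrite ?repE.
move=> _ _ _ /repP [x xt ->] /repP [y yt ->] /repP [z zt ->].
apply/imsetP; exists (pclass (param_point f (coset_op x y z))).
  by apply: imset_f; rewrite inE in_torus_coset_op.
rewrite repE ?in_torus_coset_op // param_point_coset_op coset_opZ.
by congr (_ *: _); rewrite [in RHS]mxE !invfM.
Qed.
End ParamSet.

Section CardParamSet.
Variables (K : finFieldType) (N s w : nat) (f : 'I_s.+1 -> {set 'I_N.+1}).
Hypothesis unif : forall i, #|f i| = w.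
Hypothesis constant_of_prod : forall (z : 'I_N.+1 -> K) c, (forall k, z k != 0) ->
  (forall i, \prod_(k in f i) z k = c) -> forall a b, z a = z b.

Lemma param_pointZ c (x : 'rV[K]_N.+1) :
  param_point f (c *: x) = c ^+ w *: param_point f x.
Proof.
apply/rowP=> i; rewrite !mxE -(unif i) -prodr_const -big_split.
by apply: eq_bigr => k _; rewrite mxE.
Qed.

Lemma param_setE :
  param_set K f = [set pclass (param_point f x) | x in affine_torus K N].
Proof.
apply/setP=> p; apply/imsetP/imsetP => -[x]; rewrite inE; last first.
  by case/andP=> xt _ ->; exists x; rewrite ?inE.
move=> xt ->; exists ((x 0 0)^-1 *: x); first exact: scale_affine_torus.
by rewrite param_pointZ pclassZ // expf_neq0 // invr_eq0; move/forallP: xt.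
Qed.

Lemma pclass_param_point_inj :
  {in affine_torus K N &, injective (fun x => pclass (param_point f x))}.
Proof.
move=> x y xT yT /pclass_eq_scale [c c0 /rowP xy].
have xyc : forall a b, x 0 a / y 0 a = x 0 b / y 0 b.
  apply: (constant_of_prod (c := c)) => [k|i].
    by rewrite mulf_neq0 ?invr_eq0 ?affine_torus_neq0.
  rewrite prodf_div; have := xy i; rewrite !mxE => ->; rewrite mulfK //.
  by apply/prodf_neq0=> k _; apply: affine_torus_neq0.
apply/rowP=> k; apply: divr1_eq; rewrite (xyc k 0).
by rewrite !affine_torus0 // divr1.
Qed.

Lemma card_param_set : #|param_set K f| = (#|K|.-1 ^ N)%N.
Proof.
rewrite param_setE card_in_imset ?card_affine_torus //.
exact: pclass_param_point_inj.
Qed.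
End CardParamSet.

Lemma clutter_edge_gt0 n s (f : 'I_s -> {set 'I_n}) i :
  (1 < s)%N -> is_clutter f -> (0 < #|f i|)%N.
Proof.
move=> s1 clu; rewrite card_gt0.
have /existsP [j ij] : [exists j, i != j].
  apply: contraTT s1; rewrite negb_exists -leqNgt => /forallP eqi.
  rewrite -[s]card_ord; apply/card_le1_eqP => x y _ _.
  by have := eqi x; have := eqi y; rewrite !negbK => /eqP <- /eqP <-.
by apply: contraNneq (clu _ _ ij) => ->; rewrite sub0set.
Qed.

Theorem theorem5p1 (K : finFieldType) (n s : nat) (f : 'I_s -> {set 'I_n}) :
  #|K| != 2%N ->
  (2 <= s)%N ->
  is_clutter f ->
  is_uniform f ->
  \rank (incidence_mx f) = n ->
  edge_ideal_normal f ->
  let q := #|K| in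
  let X := param_set K f in
  let T := proj_torus K n in
  (* (a) *)
  (is_degree X ((q - 1) ^ (n - 1))%N /\ #|X| = ((q - 1) ^ (n - 1))%N) /\
  (* (b) *)
  (forall d : nat, (1 <= d)%N -> (min_dist X d <= min_dist T d)%N) /\
  (* (c) *)
  (exists regX regT : nat,
     is_reg X regX /\ is_reg T regT /\ (regX <= regT)%N /\
     regT = ((q - 2) * (n - 1))%N).
Proof.
case: s f => [//|s] f _ s_gt1 clu unif rk nrm.
have w_gt0 : (0 < #|f ord0|)%N := clutter_edge_gt0 ord0 s_gt1 clu.
have unif0 i : #|f i| = #|f ord0| := unif i ord0.
case: n f {clu unif} rk nrm w_gt0 unif0 => [|N] f rk nrm w_gt0 unif0 q X T.
  by move: w_gt0; rewrite card_gt0; case/set0Pn=> -[].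
have -> : (q - 1 = #|K|.-1)%N by rewrite subn1.
have -> : ((q - 2) * (N.+1 - 1) = N * #|K|.-1.-1)%N by rewrite mulnC subn1 subn2.
rewrite subn1 /=.
have cX : #|X| = (#|K|.-1 ^ N)%N.
  exact/(card_param_set unif0)/constant_of_normal.
have XT := param_set_sub K f; have cosetX := @affine_points_param_set_coset K _ _ f.
have hX d : (N * #|K|.-1.-1 <= d)%N -> hilb X d = #|X| by apply: hilb_coset.
split; first by split=> //; exists (N * #|K|.-1.-1)%N => d /hX ->.
split=> [d _|]; first by rewrite min_dist_proj_torus min_dist_coset.
have [p regX p_le] := exists_is_reg_le hX.
by exists p, (N * #|K|.-1.-1)%N; split=> //; split; first exact: is_reg_proj_torus.
Qed.
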